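(* Let $0<p<1/2$ and let $\Phi:\mathbb{N}\rightarrow[1,\infty)$ be any non-decreasing function satisfying $$\lim_{n\rightarrow\infty}\Phi(n)=+\infty.$$ Then there exists a martingale $f\in H_p(G_2)$ such that $$\sum_{n=1}^{\infty}\frac{\log^p n\,\left\Vert R^{w}_nf\right\Vert_p^p\,\Phi(n)}{n^{2-2p}}=\infty,$$ where $R^{w}_nf$ denotes the $n$-th Riesz logarithmic mean of the Walsh-Fourier series of $f$.
   Context: Let $\mathbb{N}=\{0,1,2,\dots\}$ and $\mathbb{N}_+=\{1,2,\dots\}$. Let $G_2=\prod_{k=0}^\infty Z_2$ be the Walsh (dyadic) group, the complete direct product of copies of $Z_2=\{0,1\}$ with the product of the discrete topologies, and let $\mu$ be its Haar measure with $\mu(G_2)=1$. Elements are written $x=(x_0,x_1,\dots)$, $x_k\in\{0,1\}$. Put $I_0(x)=G_2$ and $I_n(x)=\{y\in G_2:y_0=x_0,\dots,y_{n-1}=x_{n-1}\}$ for $n\ge1$. Every $n\in\mathbb{N}$ is uniquely $n=\sum_{k=0}^\infty n_k2^k$ with $n_k\in\{0,1\}$, only finitely many nonzero. The Rademacher functions are $r_k(x)=(-1)^{x_k}$ and the Walsh (Walsh-Paley) system is $w_n(x)=\prod_{k=0}^\infty r_k^{n_k}(x)=(-1)^{\sum_k n_kx_k}$, $n\in\mathbb{N}$. Let $\digamma_n$ be the $\sigma$-algebra generated by the sets $I_n(x)$, $x\in G_2$. A martingale $f=(f^{(n)},n\in\mathbb{N})$ is a martingale with respect to $(\digamma_n)_{n\in\mathbb{N}}$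 and $\mu$. Its maximal function is $f^*=\sup_{n\in\mathbb{N}}|f^{(n)}|$. With $\|g\|_p=\left(\int_{G_2}|g|^p\,d\mu\right)^{1/p}$, the martingale Hardy space $H_p(G_2)$ consists of all martingales $f$ with $\|f\|_{H_p(G_2)}:=\|f^*\|_p<\infty$. The Walsh-Fourier coefficients of a martingale $f$ are $\widehat f(i)=\lim_{k\to\infty}\int_{G_2}f^{(k)}w_i\,d\mu$. The partial sums are $S^w_nf=\sum_{k=0}^{n-1}\widehat f(k)w_k$ for $n\in\mathbb{N}_+$. The $n$-th Riesz logarithmic mean is $$R^w_nf=\frac1{l_n}\sum_{k=1}^n\frac{S^w_kf}{k},\qquad l_n=\sum_{k=1}^n\frac1k,\qquad n\in\mathbb{N}_+.$$ Here $\log^p n$ means $(\log n)^p$. *)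

(* Defs.v *)
From HB Require Import structures.
From mathcomp Require Import all_boot all_order all_algebra.
From mathcomp Require Import all_classical all_reals all_analysis.
Set Implicit Arguments.
Unset Strict Implicit.
Unset Printing Implicit Defensive.
Import Order.TTheory GRing.Theory Num.Theory.
Import numFieldNormedType.Exports.
Local Open Scope classical_set_scope.
Local Open Scope ring_scope.

(* The dyadic group G_2 is the Cantor space
   [nat -> bool] (product of discrete two-point spaces) with its Borel
   sigma-algebra; the group law is the coordinatewise exclusive or. *)
Notation walsh_group := (g_sigma_algebraType (@open cantor_space)).

Definition wg_add (x y : walsh_group) : walsh_group :=
  fun k => x k (+) y k.

(* Together with mu setT = 1, which is part of [probability], this
   characterizes the normalized Haar measure. *)
Definition is_haar (R : realType) (mu : probability walsh_group R) : Prop :=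
  forall (x : walsh_group) (A : set walsh_group),
    measurable A -> mu (wg_add x @` A) = mu A.

Definition dyadic_interval (n : nat) (x : walsh_group) : set walsh_group :=
  [set y | forall k, (k < n)%N -> y k = x k].

(* The underlying set with the sigma-algebra generated by the I_n(x). *)
Notation dyadic_filtration n :=
  (g_sigma_algebraType (range (dyadic_interval n))).

Definition binary_digit (n k : nat) : bool := odd (n %/ 2 ^ k)%N.

Definition rademacher (R : realType) (k : nat) (x : walsh_group) : R :=
  (-1) ^+ x k.

(* The digits of index k >= n vanish since n < 2 ^ n, so the infinite product
   over k reduces to k < n. *)
Definition walsh (R : realType) (n : nat) (x : walsh_group) : R :=
  \prod_(k < n) rademacher R k x ^+ binary_digit n k.

(* The last clause is E[f^(n) | F_m] = f^(m) for m <= n. *)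
Record is_martingale (R : realType) (mu : probability walsh_group R)
    (f : nat -> walsh_group -> R) : Prop := IsMartingale {
  martingale_adapted : forall n,
    measurable_fun [set: dyadic_filtration n] (f n);
  martingale_integrable : forall n,
    mu.-integrable setT (EFin \o f n);
  martingale_cond_exp : forall (m n : nat) (A : set (dyadic_filtration m)),
    (m <= n)%N -> measurable A ->
    (\int[mu]_(x in A) f n x = \int[mu]_(x in A) f m x)%R }.

Definition maximal_function (R : realType) (f : nat -> walsh_group -> R)
    (x : walsh_group) : \bar R :=
  ereal_sup (range (fun n => `|f n x|%:E)).

Definition hardy_norm (R : realType) (mu : probability walsh_group R) (p : R)
    (f : nat -> walsh_group -> R) : \bar R :=
  Lnorm mu p%:E (maximal_function f).

Definition in_hardy (R : realType) (mu : probability walsh_group R) (p : R)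
    (f : nat -> walsh_group -> R) : Prop :=
  is_martingale mu f /\ (hardy_norm mu p f < +oo)%E.

(* For a martingale the sequence under the limit is constant as soon as
   i < 2 ^ k. *)
Definition walsh_coef (R : realType) (mu : probability walsh_group R)
    (f : nat -> walsh_group -> R) (i : nat) : R :=
  lim ((fun k : nat => \int[mu]_(x in setT) (f k x * walsh R i x))%R @ \oo).

Definition walsh_partial_sum (R : realType) (mu : probability walsh_group R)
    (f : nat -> walsh_group -> R) (n : nat) (x : walsh_group) : R :=
  \sum_(0 <= k < n) walsh_coef mu f k * walsh R k x.

Definition log_weight (R : realType) (n : nat) : R :=
  \sum_(1 <= k < n.+1) k%:R^-1.

Definition riesz_mean (R : realType) (mu : probability walsh_group R)
    (f : nat -> walsh_group -> R) (n : nat) (x : walsh_group) : R :=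
  (log_weight R n)^-1 *
  \sum_(1 <= k < n.+1) walsh_partial_sum mu f k x / k%:R.

(* Main.v *)
Require Import Defs.
From HB Require Import structures.
From mathcomp Require Import all_boot all_order all_algebra.
From mathcomp Require Import all_classical all_reals all_analysis.
From mathcomp Require Import measurable_realfun ring lra.
Set Implicit Arguments.
Unset Strict Implicit.
Unset Printing Implicit Defensive.
Import Order.TTheory GRing.Theory Num.Theory.
Import numFieldNormedType.Exports.
Local Open Scope classical_set_scope.
Local Open Scope ring_scope.

(* The martingale is a Haar series f = sum_(a >= 1) A_a r_a 1_(I_a(0))
   with A_a ^ p = 2 ^ a u_a, u_a = 1 / Phi(2 ^ a) - 1 / Phi(2 ^ (a + 1)).  For
   p <= 1 the maximal function satisfies f^* ^ p <= sum_a A_a ^ p 1_(I_a(0)),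
   whose integral is sum_a u_a <= 1.  The coefficients of f are constant on
   each dyadic block, so w_(2 j) + w_(2 j + 1) = 0 on {x_0 = 1} makes the odd
   partial sums collapse there to a single term: |S_n f| = 2 ^ (- a) A_a for odd
   n in [2 ^ a, 2 ^ (a + 1)).  Since
   l_n R_n f - l_(n - 1) R_(n - 1) f = S_n f / n, two consecutive Riesz means
   control S_n f and no kernel estimate is needed.
   Summing over the block a gives at least u_a Phi(2 ^ a) / 48, and
   sum_a u_a Phi(2 ^ a) = sum_a (1 - Phi(2 ^ a) / Phi(2 ^ (a + 1))) diverges
   because Phi is unbounded. *)

(** * Functions of finitely many coordinates and the dyadic filtration *)

Definition determined_by (T : Type) (n : nat) (f : walsh_group -> T) : Prop :=
  forall x y : walsh_group, (forall k, (k < n)%N -> x k = y k) -> f x = f y.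

Lemma determined_byW (T : Type) (m n : nat) (f : walsh_group -> T) :
  (m <= n)%N -> determined_by m f -> determined_by n f.
Proof. by move=> mn df x y xy; apply: df => k /leq_trans/(_ mn)/xy. Qed.

Lemma determined_by_comp (T U : Type) (n : nat) (f : walsh_group -> T)
  (g : T -> U) : determined_by n f -> determined_by n (g \o f).
Proof. by move=> df x y /df /= ->. Qed.

Lemma determined_by_comp2 (T U V : Type) (n : nat) (f : walsh_group -> T)
  (g : walsh_group -> U) (h : T -> U -> V) : determined_by n f ->
  determined_by n g -> determined_by n (fun x => h (f x) (g x)).
Proof. by move=> df dg x y xy; rewrite (df _ _ xy) (dg _ _ xy). Qed.

Lemma determined_by_sum (V : nmodType) (n a b : nat)
  (F : nat -> walsh_group -> V) :
  (forall i, (a <= i < b)%N -> determined_by n (F i)) ->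
  determined_by n (fun x => \sum_(a <= i < b) F i x).
Proof. by move=> dF x y xy; apply: eq_big_nat => i /dF /(_ _ _ xy). Qed.

Lemma determined_by_dyadic_interval (n : nat) (x : walsh_group) :
  determined_by n (dyadic_interval n x).
Proof.
move=> y z yz; apply/propext; split=> h k kn; first by rewrite -yz ?h.
by rewrite yz ?h.
Qed.

(** Padding a word by zeros picks one representative in each dyadic interval of rank n, so that
    unions over intervals are indexed by a finite type. *)
Definition word_extension (n : nat) (t : {ffun 'I_n -> bool}) : walsh_group :=
  fun k => if insub k is Some i then t i else false.

Lemma word_extension_prefix (n : nat) (x : walsh_group) (k : nat) :
  (k < n)%N -> word_extension [ffun i : 'I_n => x i] k = x k.
Proof. by move=> kn; rewrite /word_extension insubT /= ffunE. Qed.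

Lemma determined_by_setE (n : nat) (A : set walsh_group) :
  determined_by n A ->
  A = \bigcup_(t in [set t : {ffun 'I_n -> bool} | A (word_extension t)])
        dyadic_interval n (word_extension t).
Proof.
move=> dA; apply/seteqP; split => [x Ax|x [t At xt]].
  exists [ffun i : 'I_n => x i] => /=.
    by rewrite (dA _ x) // => k; exact: word_extension_prefix.
  by move=> k kn; rewrite word_extension_prefix.
by rewrite (dA _ _ xt).
Qed.

(** With the converse below, this identifies the n-th sigma-algebra with the sets determined by the
    first n coordinates; martingale conditions become statements about coordinates. *)
Lemma determined_by_measurable_filtration (n : nat)
  (A : set (dyadic_filtration n)) : determined_by n A -> measurable A.
Proof.
move=> dA; rewrite (determined_by_setE dA); apply: fin_bigcup_measurable => //.
by move=> t _; apply: sub_sigma_algebra; exists (word_extension t).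
Qed.

Lemma measurable_filtration_determined_by (n : nat)
  (A : set (dyadic_filtration n)) : measurable A -> determined_by n A.
Proof.
suff : <<s range (dyadic_interval n)>> `<=` [set A | determined_by n A] by exact.
apply: smallest_sub; last first.
  by move=> _ [x _ <-]; exact: determined_by_dyadic_interval.
split=> [//|B dB|F dF] x y xy /=.
  by rewrite /setD /= (dB _ _ xy).
apply/propext; split=> -[i _ Fi]; exists i => //.
  by rewrite -(dF i _ _ xy).
by rewrite (dF i _ _ xy).
Qed.

Lemma cantor_coordinate_continuous (k : nat) :
  continuous ((fun x => x k) : cantor_space -> bool).
Proof. exact: (@proj_continuous nat (fun=> bool) k). Qed.

Lemma measurable_coordinate (k : nat) (b : bool) :
  measurable [set x : walsh_group | x k = b].
Proof.
apply: sub_sigma_algebra.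
have := (continuousP _).1 (@cantor_coordinate_continuous k) [set b].
by apply; exact: discrete_open.
Qed.

Lemma measurable_dyadic_interval (n : nat) (x : walsh_group) :
  measurable (dyadic_interval n x).
Proof.
have -> : dyadic_interval n x =
    \bigcap_(k in `I_n) [set y : walsh_group | y k = x k] by [].
by apply: fin_bigcap_measurable => // k _; exact: measurable_coordinate.
Qed.

Lemma determined_by_measurable (n : nat) (A : set walsh_group) :
  determined_by n A -> measurable A.
Proof.
move=> dA; rewrite (determined_by_setE dA); apply: fin_bigcup_measurable => //.
by move=> t _; exact: measurable_dyadic_interval.
Qed.

Lemma determined_by_measurable_fun (d : measure_display)
  (T : measurableType d) (n : nat) (A : set walsh_group)
  (f : walsh_group -> T) :
  determined_by n f -> measurable_fun A f.
Proof.
move=> df mA Y mY; apply: measurableI => //.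
apply: (@determined_by_measurable n).
exact: determined_by_comp df.
Qed.

Lemma determined_by_integrable (R : realType)
  (mu : probability walsh_group R) (n : nat) (A : set walsh_group)
  (f : walsh_group -> R) : measurable A -> determined_by n f ->
  mu.-integrable A (EFin \o f).
Proof.
move=> mA df; apply: measurable_bounded_integrable => //.
- by rewrite (le_lt_trans (probability_le1 mu mA)) ?ltry.
- exact: determined_by_measurable_fun df.
(* Only finitely many values are taken, one for each word; the sum of their absolute values is a
   bound. *)
exists (\sum_(t : {ffun 'I_n -> bool}) `|f (word_extension t)|).
split; first exact: num_real.
move=> M hM x _ /=; apply: le_trans (ltW hM).
have -> : f x = f (word_extension [ffun i : 'I_n => x i]).
  by apply: df => k kn; rewrite word_extension_prefix.
by rewrite (bigD1 [ffun i : 'I_n => x i]) //= lerDl sumr_ge0.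
Qed.

(** * Translations and Haar measure *)

Lemma wg_add_continuous (a : cantor_space) :
  continuous (wg_add a : cantor_space -> cantor_space).
Proof.
move=> x; apply/cvg_sup => k; apply/cvg_image.
  by apply/seteqP; split=> // b _; exists (fun=> b).
move=> B nB /=.
exists [set y : cantor_space | B (y k)]; last first.
  apply/seteqP; split=> [_ [y By <-] //|b Bb]; exists (fun=> b) => //.
have h : nbhs x [set y : cantor_space | y k = x k].
  by apply: (@cantor_coordinate_continuous k x [set x k]); exact: discrete_set1.
apply: (@filterS _ (nbhs x) _ _ _ _ h) => y /= yx.
by rewrite /wg_add yx; exact: nbhs_singleton nB.
Qed.

Lemma measurable_wg_add (a : walsh_group) :
  measurable_fun setT (wg_add a : walsh_group -> walsh_group).
Proof.
move=> _; apply: measurability => //.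
move=> _ [U oU <-]; rewrite setTI; apply: sub_sigma_algebra.
exact: (continuousP _).1 (@wg_add_continuous a) U oU.
Qed.

Lemma wg_addK (a : walsh_group) : involutive (wg_add a).
Proof. by move=> x; apply/funext => k; rewrite /wg_add addbA addbb. Qed.

(** Translation by a is an involution, so preimages are images and [is_haar] says that the
    pushforward of [mu] is [mu] itself; the rest is change of variables. *)
Lemma haar_integral_translate (R : realType) (mu : probability walsh_group R)
    (mu_haar : is_haar mu) (a : walsh_group) (A : set walsh_group)
    (f : walsh_group -> \bar R) :
  measurable A -> measurable_fun setT f ->
  mu.-integrable A (fun x => f (wg_add a x)) ->
  (forall x, A (wg_add a x) <-> A x) ->
  (\int[mu]_(x in A) f (wg_add a x) = \int[mu]_(x in A) f x)%E.
Proof.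
move=> mA mf intf invA.
have preA : wg_add a @^-1` A = A.
  by apply/seteqP; split=> x; move/invA.
have pre (B : set walsh_group) : wg_add a @^-1` B = wg_add a @` B.
  apply/seteqP; split=> x /= => [Bx|[y By <-]]; last by rewrite wg_addK.
  by exists (wg_add a x) => //; rewrite wg_addK.
have := integral_pushforward (measurable_wg_add a) mf _ mA.
rewrite preA => /(_ _ intf) => <-.
apply: eq_measure_integral => [|? B mB _]; first exact: measurable_wg_add.
exact: etrans (congr1 mu (pre B)) (mu_haar a B mB).
Qed.

(** Translation invariance equates the integral with its opposite. All later cancellations come from
    here, with a flip of one coordinate as translation. *)
Lemma haar_Rintegral_odd (R : realType) (mu : probability walsh_group R)
    (mu_haar : is_haar mu) (a : walsh_group) (n : nat) (A : set walsh_group)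
    (f : walsh_group -> R) :
  measurable A -> determined_by n f ->
  (forall x, A (wg_add a x) <-> A x) ->
  (forall x, f (wg_add a x) = - f x) ->
  (\int[mu]_(x in A) f x)%R = 0.
Proof.
move=> mA df invA oddf; apply/eqP; rewrite -eqNr; apply/eqP.
rewrite -mulN1r -RintegralZl //; last exact: determined_by_integrable df.
rewrite /Rintegral -[in RHS](@haar_integral_translate _ _ mu_haar a) //.
- by congr fine; apply: eq_integral => x _; rewrite mulN1r oddf.
- by apply/measurable_EFinP; exact: determined_by_measurable_fun df.
- apply: (@determined_by_integrable _ _ n _ (fun x => f (wg_add a x))) => //.
  by move=> x y xy; rewrite !oddf (df _ _ xy).
Qed.

Definition wg_zero : walsh_group := fun=> false.

Definition wg_unit (k : nat) : walsh_group := fun j => j == k.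

Lemma determined_by_wg_unit (T : Type) (n k : nat) (f : walsh_group -> T)
  (x : walsh_group) : determined_by n f -> (n <= k)%N ->
  f (wg_add (wg_unit k) x) = f x.
Proof.
move=> df nk; apply: df => j jn; rewrite /wg_add /wg_unit.
by rewrite (_ : (j == k) = false) // ltn_eqF // (leq_trans jn).
Qed.

(** I_n(0) is the disjoint union of I_(n + 1)(0) and its translate by the n-th unit vector, so the
    measure halves at each step. *)
Lemma haar_dyadic_interval0 (R : realType) (mu : probability walsh_group R)
    (mu_haar : is_haar mu) (n : nat) :
  mu (dyadic_interval n wg_zero) = (2^-1 ^+ n)%:E.
Proof.
elim: n => [|n IHn].
  rewrite expr0 -(@probability_setT _ _ _ mu); congr (mu _).
  by apply/seteqP; split.
have split_In : dyadic_interval n wg_zero = dyadic_interval n.+1 wg_zero `|`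
    wg_add (wg_unit n) @` dyadic_interval n.+1 wg_zero.
  apply/seteqP; split => x => [x0|[|[y y0 <-]]].
  - have [xn|xn] := boolP (x n).
      right; exists (wg_add (wg_unit n) x); last by rewrite wg_addK.
      move=> k; rewrite ltnS leq_eqVlt /wg_add /wg_unit => /predU1P[->|kn].
        by rewrite eqxx xn.
      by rewrite (ltn_eqF kn) x0.
    left=> k; rewrite ltnS leq_eqVlt => /predU1P[->|kn]; last exact: x0.
    exact: negbTE.
  - by move=> x0 k kn; apply: x0; exact: ltnW.
  - move=> k kn; rewrite /wg_add /wg_unit (ltn_eqF kn) /= y0 //; exact: ltnW.
have mI := measurable_dyadic_interval n.+1 wg_zero.
have double : mu (dyadic_interval n wg_zero) =
    (mu (dyadic_interval n.+1 wg_zero) + mu (dyadic_interval n.+1 wg_zero))%E.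
  rewrite {1}split_In measureU //.
  - by congr (_ + _)%E; exact: mu_haar.
  - rewrite (_ : _ @` _ = dyadic_interval n.+1 (wg_unit n)).
      exact: measurable_dyadic_interval.
    apply/seteqP; split=> x => [[y y0 <-] k kn|x1].
      by rewrite /wg_add (y0 _ kn) addbF.
    exists (wg_add (wg_unit n) x); last by rewrite wg_addK.
    by move=> k kn; rewrite /wg_add x1 // addbb.
  - apply/seteqP; split=> // x [x0 [y y0]] xy.
    have := x0 n (leqnn _); rewrite -xy /wg_add /wg_unit eqxx.
    by rewrite (y0 n (leqnn _)).
have mfin : mu (dyadic_interval n.+1 wg_zero) \is a fin_num.
  exact: fin_num_measure.
move: IHn; rewrite double -(fineK mfin) -EFinD => -[h].
by congr EFin; rewrite exprS; lra.
Qed.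

(** * Binary digits and Walsh functions *)

Lemma binary_digit_small (n k : nat) :
  (n < 2 ^ k)%N -> binary_digit n k = false.
Proof. by move=> nk; rewrite /binary_digit divn_small. Qed.

Lemma binary_digit_trunc_log (n : nat) :
  (0 < n)%N -> binary_digit n (trunc_log 2 n).
Proof.
move=> n0; have /andP[lo hi] := trunc_log_bounds (isT : (1 < 2)%N) n0.
rewrite /binary_digit; suff -> : (n %/ 2 ^ trunc_log 2 n)%N = 1%N by [].
apply/eqP; rewrite eqn_leq; apply/andP; split.
  by rewrite -ltnS ltn_divLR ?expn_gt0 // -expnS.
by rewrite leq_divRL ?expn_gt0 // mul1n.
Qed.

Lemma rademacher_wg_unit (R : realType) (j k : nat) (x : walsh_group) :
  rademacher R j (wg_add (wg_unit k) x) = (-1) ^+ (j == k) * rademacher R j x.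
Proof. by rewrite /rademacher /wg_add signr_addb. Qed.

(** Digits of index at least n vanish because n < 2 ^ n. A larger cutoff is needed to include a
    prescribed coordinate k in the product. *)
Lemma walshE (R : realType) (n m : nat) (x : walsh_group) : (n <= m)%N ->
  walsh R n x = \prod_(k < m) rademacher R k x ^+ binary_digit n k.
Proof.
move=> nm; rewrite /walsh -(subnKC nm) big_split_ord /=
  [X in _ * X]big1 ?mulr1 //.
move=> k _; rewrite binary_digit_small ?expr0 //.
by rewrite (leq_trans (ltn_expl _ (isT : (1 < 2)%N))) // leq_pexp2l // leq_addr.
Qed.

Lemma walsh_wg_unit (R : realType) (n k : nat) (x : walsh_group) :
  walsh R n (wg_add (wg_unit k) x) = (-1) ^+ binary_digit n k * walsh R n x.
Proof.
rewrite !(@walshE _ n (n + k.+1)) ?leq_addr //.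
under eq_bigr do rewrite rademacher_wg_unit exprMn.
rewrite big_split /=; congr (_ * _).
have kn : (k < n + k.+1)%N by rewrite addnS ltnS leq_addl.
rewrite (bigD1 (Ordinal kn)) //= eqxx expr1 big1 ?mulr1 // => j.
by rewrite -val_eqE /= => /negbTE ->; rewrite expr0 expr1n.
Qed.

Lemma determined_by_walsh (R : realType) (n : nat) :
  determined_by n (walsh R n).
Proof.
by move=> x y xy; apply: eq_bigr => k _; rewrite /rademacher xy.
Qed.

Lemma normr_walsh (R : realType) (n : nat) (x : walsh_group) :
  `|walsh R n x| = 1.
Proof.
rewrite /walsh normr_prod big1 // => k _.
by rewrite normrX /rademacher normrX normrN1 !expr1n.
Qed.

(** The binary digits of 2 j and 2 j + 1 differ only at index 0. *)
Lemma walsh_odd (R : realType) (j : nat) (x : walsh_group) :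
  walsh R j.*2.+1 x = rademacher R 0 x * walsh R j.*2 x.
Proof.
rewrite (@walshE _ j.*2 j.*2.+1) // /walsh !big_ord_recl /=.
rewrite /binary_digit !expn0 !divn1 /= odd_double expr1 expr0 mul1r.
congr (_ * _); apply: eq_bigr => k _; congr (_ ^+ nat_of_bool (odd _)).
rewrite /bump /= add1n expnS !divnMA; congr (_ %/ _)%N.
by rewrite !divn2 /= uphalf_double doubleK.
Qed.

(** * Haar series: martingale property and Walsh coefficients *)

Definition haar_fun (R : realType) (a : nat) (x : walsh_group) : R :=
  rademacher R a x * \1_(dyadic_interval a wg_zero) x.

(** In terms of Dirichlet kernels, [haar_fun R a] is 2 ^ (- a) (D_(2 ^ (a + 1)) - D_(2 ^ a)). It
    depends on the coordinates 0 to a, so stopping before n keeps the n-th sum adapted to level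
    n. *)
Definition haar_series (R : realType) (A : nat -> R) (n : nat)
    (x : walsh_group) : R :=
  \sum_(0 <= a < n) A a * haar_fun R a x.

Lemma determined_by_indic (R : realType) (n : nat) (A : set walsh_group) :
  determined_by n A -> determined_by n (\1_A : walsh_group -> R).
Proof.
move=> dA x y xy; rewrite !indicE; congr (nat_of_bool _)%:R.
by apply/idP/idP; rewrite !inE (dA _ _ xy).
Qed.

Lemma determined_by_haar_fun (R : realType) (a n : nat) :
  (a < n)%N -> determined_by n (haar_fun R a).
Proof.
move=> an; apply: determined_by_comp2.
  by move=> x y xy; rewrite /rademacher xy.
apply: determined_by_indic; apply: determined_byW (ltnW an) _.
exact: determined_by_dyadic_interval.
Qed.

Lemma determined_by_haar_series (R : realType) (A : nat -> R) (n : nat) :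
  determined_by n (haar_series A n).
Proof.
apply: determined_by_sum => a /= an x y xy.
by rewrite (@determined_by_haar_fun R _ _ an _ _ xy).
Qed.

Lemma haar_fun_wg_unit (R : realType) (a k : nat) (x : walsh_group) :
  (a <= k)%N ->
  haar_fun R a (wg_add (wg_unit k) x) = (-1) ^+ (a == k) * haar_fun R a x.
Proof.
move=> ak; rewrite /haar_fun rademacher_wg_unit -mulrA; congr (_ * (_ * _)).
apply: determined_by_wg_unit ak; apply: determined_by_indic.
exact: determined_by_dyadic_interval.
Qed.

(** Flipping coordinate a preserves B and reverses the sign of the function. This is the martingale
    difference property. *)
Lemma Rintegral_haar_fun (R : realType) (mu : probability walsh_group R)
    (mu_haar : is_haar mu) (m a : nat) (B : set walsh_group) :
  determined_by m B -> (m <= a)%N ->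
  (\int[mu]_(x in B) haar_fun R a x)%R = 0.
Proof.
move=> dB ma; apply: (@haar_Rintegral_odd _ _ mu_haar (wg_unit a) a.+1).
- exact: determined_by_measurable dB.
- exact: determined_by_haar_fun.
- by move=> x; rewrite (determined_by_wg_unit x dB ma).
- by move=> x; rewrite haar_fun_wg_unit // eqxx mulN1r.
Qed.

Lemma haar_series_martingale (R : realType) (mu : probability walsh_group R)
    (mu_haar : is_haar mu) (A : nat -> R) : is_martingale mu (haar_series A).
Proof.
split.
- move=> n _ Y mY; rewrite setTI; apply: determined_by_measurable_filtration.
  exact: determined_by_comp (@determined_by_haar_series _ _ _).
- by move=> n; apply: determined_by_integrable (@determined_by_haar_series _ _ _).
- move=> m n B mn /measurable_filtration_determined_by dB.
  have mB := determined_by_measurable dB.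
  elim: n mn => [|n IHn]; first by rewrite leqn0 => /eqP ->.
  rewrite leq_eqVlt => /predU1P[->//|]; rewrite ltnS => mn.
  rewrite -(IHn mn) /haar_series.
  under eq_Rintegral do rewrite big_nat_recr //=.
  have dn : determined_by n.+1 (haar_fun R n) by exact: determined_by_haar_fun.
  rewrite RintegralD //; last first.
  + by apply: (@determined_by_integrable _ _ n.+1) => // x y xy; rewrite (dn _ _ xy).
  + exact: determined_by_integrable (@determined_by_haar_series _ A n).
  rewrite RintegralZl //; last exact: determined_by_integrable dn.
  by rewrite (Rintegral_haar_fun mu_haar dB mn) mulr0 addr0.
Qed.

(** On this interval the Rademacher factors below the leading digit equal 1, and above it the digits
    vanish; only the leading factor survives. *)
Lemma walsh_on_dyadic_interval0 (R : realType) (i : nat) (x : walsh_group) :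
  (0 < i)%N -> dyadic_interval (trunc_log 2 i) wg_zero x ->
  walsh R i x = rademacher R (trunc_log 2 i) x.
Proof.
move=> i0 x0; rewrite /walsh.
have ti : (trunc_log 2 i < i)%N.
  by rewrite (leq_trans (ltn_expl _ (isT : (1 < 2)%N))) // trunc_logP.
rewrite (bigD1 (Ordinal ti)) //= binary_digit_trunc_log // expr1 big1 ?mulr1 //.
move=> k; rewrite -val_eqE /= neq_ltn => /orP[kt|tk].
  by rewrite /rademacher x0 // expr0 expr1n.
rewrite binary_digit_small ?expr0 //.
by rewrite (leq_trans (trunc_log_ltn _ (isT : (1 < 2)%N))) // leq_pexp2l.
Qed.

(** Let t be the index of the leading digit of i. If a = t the product is the indicator of I_t(0).
    If a < t, flipping coordinate t reverses only the Walsh factor; if a > t, flipping coordinate a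
    reverses only the Haar factor. *)
Lemma Rintegral_haar_fun_walsh (R : realType) (mu : probability walsh_group R)
    (mu_haar : is_haar mu) (a i : nat) : (0 < i)%N ->
  (\int[mu]_x (haar_fun R a x * walsh R i x))%R =
  if a == trunc_log 2 i then 2^-1 ^+ a else 0.
Proof.
move=> i0; have /andP[lo hi] := trunc_log_bounds (isT : (1 < 2)%N) i0.
have dw : determined_by (a.+1 + i) (fun x => haar_fun R a x * walsh R i x).
  apply: determined_by_comp2.
    by apply: determined_by_haar_fun; rewrite leq_addr.
  by apply: determined_byW (@determined_by_walsh R i); rewrite leq_addl.
have [-> {dw}|ne] := eqVneq a (trunc_log 2 i).
  set t := trunc_log 2 i.
  rewrite (@eq_Rintegral _ _ _ _ _ (\1_(dyadic_interval t wg_zero))).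
    rewrite /Rintegral integral_indic //; last exact: measurable_dyadic_interval.
    by rewrite setIT; exact: (congr1 (@fine R) (haar_dyadic_interval0 mu_haar t)).
  move=> x _; rewrite /haar_fun indicE.
  have [|_] := boolP (x \in _); last by rewrite mulr0 mul0r.
  rewrite inE => x0; rewrite (walsh_on_dyadic_interval0 _ i0 x0).
  by rewrite mulr1 /rademacher -expr2 sqrr_sign.
move: ne; rewrite neq_ltn => /orP[at_|ta].
  apply: (@haar_Rintegral_odd _ _ mu_haar (wg_unit (trunc_log 2 i)) _ _ _ _ dw) => // x.
  rewrite haar_fun_wg_unit 1?ltnW // (ltn_eqF at_) mul1r walsh_wg_unit.
  by rewrite binary_digit_trunc_log // expr1 mulN1r mulrN.
apply: (@haar_Rintegral_odd _ _ mu_haar (wg_unit a) _ _ _ _ dw) => // x.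
rewrite haar_fun_wg_unit // eqxx walsh_wg_unit binary_digit_small.
  by rewrite expr0 expr1 mulN1r mul1r mulNr.
by rewrite (leq_trans hi) // leq_pexp2l.
Qed.

Lemma Rintegral_haar_series_walsh (R : realType)
    (mu : probability walsh_group R) (mu_haar : is_haar mu) (A : nat -> R)
    (n i : nat) : (i < 2 ^ n)%N -> A 0%N = 0 ->
  (\int[mu]_x (haar_series A n x * walsh R i x))%R =
  A (trunc_log 2 i) * 2^-1 ^+ trunc_log 2 i.
Proof.
move=> hi A0.
have split_sum k :
    (\int[mu]_x (haar_series A k x * walsh R i x))%R =
    \sum_(0 <= a < k) A a * (\int[mu]_x (haar_fun R a x * walsh R i x))%R.
  elim: k => [|k IHk].
    rewrite big_geq // (@eq_Rintegral _ _ _ _ _ (fun=> 0)) ?Rintegral_cst ?mul0r//.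
    by move=> x _; rewrite /haar_series big_geq // mul0r.
  rewrite big_nat_recr //= -IHk -RintegralZl //; last first.
    apply: (@determined_by_integrable _ _ (k.+1 + i)) => //.
    apply: determined_by_comp2.
      by apply: determined_by_haar_fun; rewrite leq_addr.
    by apply: determined_byW (@determined_by_walsh R i); rewrite leq_addl.
  rewrite -RintegralD //.
  - by apply: eq_Rintegral => x _; rewrite /haar_series big_nat_recr //= mulrDl mulrA.
  - apply: (@determined_by_integrable _ _ (k + i)) => //.
    apply: determined_by_comp2.
      by apply: determined_byW (@determined_by_haar_series R A k); rewrite leq_addr.
    by apply: determined_byW (@determined_by_walsh R i); rewrite leq_addl.
  - apply: (@determined_by_integrable _ _ (k.+1 + i)) => //.
    apply: (@determined_by_comp _ _ _ _ (fun y => A k * y)).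
    apply: determined_by_comp2.
      by apply: determined_by_haar_fun; rewrite leq_addr.
    by apply: determined_byW (@determined_by_walsh R i); rewrite leq_addl.
(* Since [trunc_log 2 0] is 0, the formula reads [A 0] at i = 0, whereas the integral of the series
   is 0; the hypothesis on [A 0] reconciles the two. *)
rewrite split_sum; have [->|i0] := posnP i.
  rewrite trunc_log0 A0 mul0r big1_seq // => -[|a] _; first by rewrite A0 mul0r.
  rewrite (@eq_Rintegral _ _ _ _ _ (haar_fun R a.+1)).
    by rewrite (@Rintegral_haar_fun _ _ mu_haar 0) ?mulr0.
  by move=> x _; rewrite /walsh big_ord0 mulr1.
have tn : (trunc_log 2 i < n)%N.
  by rewrite -(ltn_exp2l _ _ (isT : (1 < 2)%N)) (leq_ltn_trans _ hi) // trunc_logP.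
rewrite (bigD1_seq (trunc_log 2 i)) ?iota_uniq ?mem_index_iota //=.
rewrite Rintegral_haar_fun_walsh // eqxx big1 ?addr0 // => a /negbTE ne.
by rewrite Rintegral_haar_fun_walsh // ne mulr0.
Qed.

Lemma walsh_coef_haar_series (R : realType) (mu : probability walsh_group R)
    (mu_haar : is_haar mu) (A : nat -> R) (i : nat) : A 0%N = 0 ->
  walsh_coef mu (haar_series A) i = A (trunc_log 2 i) * 2^-1 ^+ trunc_log 2 i.
Proof.
move=> A0; apply: lim_near_cst => //.
(* The sequence is constant once n >= i, because i < 2 ^ i. *)
near=> n; apply: Rintegral_haar_series_walsh => //.
apply: leq_trans (ltn_expl i (isT : (1 < 2)%N)) _.
by rewrite leq_pexp2l //; near: n; exact: nbhs_infty_ge.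
Unshelve. all: by end_near. Qed.

Lemma trunc_log2_doubleS (j : nat) : trunc_log 2 j.*2.+1 = trunc_log 2 j.*2.
Proof.
case: j => [//|j]; rewrite trunc_log2_double // trunc_log2S //.
by have -> : (j.+1.*2.+1./2 = j.+1)%N by rewrite /= uphalf_double.
Qed.

(** The indices 2 i and 2 i + 1 carry equal coefficients, and r_0 = -1 makes their Walsh functions
    opposite. All pairs cancel, leaving the unpaired last index 2 j. *)
Lemma walsh_partial_sum_haar_series_odd (R : realType)
    (mu : probability walsh_group R) (mu_haar : is_haar mu) (A : nat -> R)
    (j : nat) (x : walsh_group) : A 0%N = 0 -> x 0%N ->
  walsh_partial_sum mu (haar_series A) j.*2.+1 x =
  A (trunc_log 2 j.*2) * 2^-1 ^+ trunc_log 2 j.*2 * walsh R j.*2 x.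
Proof.
move=> A0 x0; rewrite /walsh_partial_sum big_nat_recr //=.
rewrite walsh_coef_haar_series // -[RHS]add0r; congr (_ + _).
elim: j => [|j IHj]; first by rewrite big_geq.
rewrite doubleS !big_nat_recr //= IHj add0r !walsh_coef_haar_series //.
rewrite trunc_log2_doubleS -mulrDr walsh_odd /rademacher x0 expr1 mulN1r.
by rewrite subrr mulr0.
Qed.

(** * Subadditivity of p-th powers and the Hardy norm *)

Lemma powRD_le (R : realType) (p a b : R) : 0 < p -> p <= 1 -> 0 <= a ->
  0 <= b -> (a + b) `^ p <= a `^ p + b `^ p.
Proof.
move=> p0 p1 a0 b0; have [ab0|ab_neq0] := eqVneq (a + b) 0.
  by rewrite ab0 powR0 ?gt_eqF // addr_ge0 // powR_ge0.
have ab_gt0 : 0 < a + b by rewrite lt_neqAle eq_sym ab_neq0 addr_ge0.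
(* The ratio s = c / (a + b) lies in [0, 1], where s <= s ^ p; the cases c = a and c = b add up to
   the claim. *)
have le_frac c : 0 <= c -> c <= a + b ->
    c / (a + b) * (a + b) `^ p <= c `^ p.
  rewrite le_eqVlt => /predU1P[<-|c0] cab; first by rewrite !mul0r powR_ge0.
  rewrite -{2}(divfK ab_neq0 c) powRM ?divr_ge0 ?(ltW ab_gt0) ?(ltW c0) //.
  rewrite ler_wpM2r ?powR_ge0 // ger1_powR // divr_gt0 //=.
  by rewrite ler_pdivrMr // mul1r.
have -> : (a + b) `^ p =
    a / (a + b) * (a + b) `^ p + b / (a + b) * (a + b) `^ p.
  by rewrite -mulrDl -mulrDl divff // mul1r.
by rewrite lerD // le_frac // ?lerDl ?lerDr.
Qed.

Lemma powR_sum_le (R : realType) (p : R) (n : nat) (F : nat -> R) :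
  0 < p -> p <= 1 ->
  `|\sum_(0 <= i < n) F i| `^ p <= \sum_(0 <= i < n) `|F i| `^ p.
Proof.
move=> p0 p1; elim: n => [|n IHn].
  by rewrite !big_geq // normr0 powR0 ?gt_eqF.
rewrite !big_nat_recr //=; apply: le_trans (lerD IHn (lexx _)).
apply: le_trans (powRD_le p0 p1 _ _) => //.
by apply: ge0_ler_powR; rewrite ?nnegrE ?addr_ge0 ?ler_normD // ltW.
Qed.

Lemma normr_haar_fun (R : realType) (a : nat) (x : walsh_group) :
  `|haar_fun R a x| = \1_(dyadic_interval a wg_zero) x.
Proof.
by rewrite /haar_fun normrM /rademacher normrX normrN1 expr1n mul1r ger0_norm.
Qed.

Lemma powR_haar_series_le (R : realType) (p : R) (A : nat -> R) (n : nat)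
    (x : walsh_group) : 0 < p -> p <= 1 -> (forall a, 0 <= A a) ->
  `|haar_series A n x| `^ p <=
  \sum_(0 <= a < n) A a `^ p * \1_(dyadic_interval a wg_zero) x.
Proof.
move=> p0 p1 A0; apply: le_trans (powR_sum_le _ _ p0 p1) _.
apply: ler_sum => a _; rewrite normrM normr_haar_fun ger0_norm // indicE.
by case: (x \in _); rewrite ?mulr1 // !mulr0 powR0 // gt_eqF.
Qed.

Lemma haar_series_in_hardy (R : realType) (mu : probability walsh_group R)
    (mu_haar : is_haar mu) (p : R) (A : nat -> R) (M : R) :
  0 < p -> p <= 1 -> (forall a, 0 <= A a) ->
  (forall n, \sum_(0 <= a < n) A a `^ p * 2^-1 ^+ a <= M) ->
  in_hardy mu p (haar_series A).
Proof.
move=> p0 p1 A0 leM; split; first exact: haar_series_martingale.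
have p_neq0 : p != 0 by rewrite gt_eqF.
pose g a (x : walsh_group) : \bar R :=
  (A a `^ p * \1_(dyadic_interval a wg_zero) x)%:E.
have g0 a x : (0 <= g a x)%E by rewrite lee_fin mulr_ge0 ?powR_ge0.
have mg a : measurable_fun [set: walsh_group] (g a).
  apply/measurable_EFinP; apply: (@determined_by_measurable_fun _ _ a).
  apply: (@determined_by_comp _ _ _ _ (fun y => A a `^ p * y)).
  exact/determined_by_indic/determined_by_dyadic_interval.
(* An integrable majorant of the p-th power of the maximal function. *)
pose G x := (\sum_(a <oo) g a x)%E.
have G0 x : (0 <= G x)%E by exact: nneseries_ge0.
have maxf0 x : (0 <= maximal_function (haar_series A) x)%E.
  apply: (@le_trans _ _ `|haar_series A 0 x|%:E); first by rewrite lee_fin.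
  by apply: ereal_sup_ubound; exists 0%N.
have maxfG x : (maximal_function (haar_series A) x `^ p <= G x)%E.
  (* Taking p-th roots removes the power from the supremum: it suffices to bound each term by G ^ (1
     / p). *)
  have -> : G x = ((G x `^ p^-1) `^ p)%E by rewrite -poweRrM mulVf // poweRe1.
  apply: gt0_ler_poweR; rewrite ?in_itv /= ?leey ?andbT ?poweR_ge0 ?maxf0 ?(ltW p0) //.
  apply: ge_ereal_sup => _ [n _ <-].
  have -> : (`|haar_series A n x|%:E = (`|haar_series A n x| `^ p)%:E `^ p^-1)%E.
    by rewrite -poweR_EFin -poweRrM mulfV // poweRe1.
  apply: gt0_ler_poweR; rewrite ?in_itv /= ?leey ?andbT ?G0 ?lee_fin ?powR_ge0 //.
    by rewrite invr_ge0 ltW.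
  apply: le_trans (nneseries_lim_ge n _); last by move=> a _ _; exact: g0.
  by rewrite sumEFin lee_fin powR_haar_series_le.
have mmaxf :
    measurable_fun [set: walsh_group] (maximal_function (haar_series A)).
  have -> : maximal_function (haar_series A) =
      (fun x => esups (fun n => `|haar_series A n x|%:E) 0%N).
    apply/funext => x; congr ereal_sup; apply/seteqP.
    by split=> _ [n _ <-]; exists n.
  apply: (@measurable_fun_esups _ _ _ _ (fun n x => `|haar_series A n x|%:E)) => n.
  apply/measurable_EFinP; apply: (@determined_by_measurable_fun _ _ n).
  exact: (determined_by_comp _ (@determined_by_haar_series _ A n)).
rewrite /hardy_norm unlock; apply: poweR_lty.
apply: (@le_lt_trans _ _ (\int[mu]_x G x)%E).
  apply: ge0_le_integral => //.
  - by move=> x _; exact: poweR_ge0.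
  - apply: (@measurableT_comp _ _ _ _ _ _ (fun y => (y `^ p)%E)).
      exact: measurable_poweR.
    exact: measurableT_comp.
  - exact: ge0_emeasurable_sum.
  - by move=> x _; rewrite gee0_abs.
(* Integration term by term yields mu(I_a(0)) = 2 ^ (- a), hence the partial sums bounded by M. *)
rewrite integral_nneseries //; apply: (@le_lt_trans _ _ M%:E); last exact: ltry.
apply: lime_le; first by apply: is_cvg_nneseries => n _ _; exact: integral_ge0.
near=> n; rewrite (eq_bigr (fun a => (A a `^ p * 2^-1 ^+ a)%:E)).
  by rewrite sumEFin lee_fin.
move=> a _; rewrite /g; under eq_integral do rewrite EFinM.
rewrite ge0_integralZl //; last 2 first.
- apply/measurable_EFinP; apply: (@determined_by_measurable_fun _ _ a).
  exact/determined_by_indic/determined_by_dyadic_interval.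
- by rewrite lee_fin powR_ge0.
rewrite integral_indic //; last exact: measurable_dyadic_interval.
by rewrite setIT EFinM; congr (_ * _)%E; exact: haar_dyadic_interval0.
Unshelve. all: by end_near. Qed.

(** * Logarithmic weights, constants and a divergence criterion *)

Lemma ln_succ_ge (R : realType) (n : nat) : (0 < n)%N ->
  ln n%:R + n.+1%:R^-1 <= ln n.+1%:R :> R.
Proof.
move=> n0; have n0' : 0 < n%:R :> R by rewrite ltr0n.
have nS0 : 0 < n.+1%:R :> R by rewrite ltr0n.
(* This is ln (1 + x) <= x at x = - 1 / (n + 1). *)
have : ln (n%:R / n.+1%:R) <= - n.+1%:R^-1 :> R.
  have -> : n%:R / n.+1%:R = 1 + - n.+1%:R^-1 :> R.
    by rewrite -[n%:R](addrK 1) natr1 mulrBl divff ?mul1r // lt0r_neq0.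
  by rewrite le_ln1Dx // ltrN2 invf_lt1 // ltr1n.
rewrite ln_div ?posrE //; move: (ln _) (ln _) (_^-1) => a b c ?; lra.
Qed.

Lemma log_weight_gt0 (R : realType) (n : nat) : (0 < n)%N -> 0 < log_weight R n.
Proof.
move=> n0; rewrite /log_weight big_ltn // invr1 ltr_pwDl //.
by rewrite sumr_ge0.
Qed.

(** The constant 3 comes from l_n <= 1 + ln n and 1 <= 2 ln 2 <= 2 ln n, the latter for n >= 2. *)
Lemma log_weight_le (R : realType) (n : nat) : (1 < n)%N ->
  log_weight R n <= 3 * ln n%:R.
Proof.
have half_le : 2^-1 <= ln 2 :> R.
  by have := @ln_succ_ge R 1 isT; rewrite ln1 add0r.
have le1D k : log_weight R k.+1 <= 1 + ln k.+1%:R.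
  elim: k => [|k IHk].
    by rewrite /log_weight big_nat1 invr1 ln1 addr0.
  rewrite /log_weight big_nat_recr //= -/(log_weight R k.+1).
  by apply: le_trans (lerD IHk (lexx _)) _; rewrite -addrA lerD2l ln_succ_ge.
case: n => [//|n] n1; have := le1D n.
have : ln 2 <= ln n.+1%:R :> R by rewrite ler_ln ?posrE ?ltr0n // ler_nat.
move: (ln n.+1%:R) => a ? ?; lra.
Qed.

Lemma big_nat_double (R : Type) (idx : R) (op : Monoid.law idx) (m n : nat)
    (F : nat -> R) : (m <= n)%N ->
  \big[op/idx]_(m.*2 <= i < n.*2) F i =
  \big[op/idx]_(m <= j < n) op (F j.*2) (F j.*2.+1).
Proof.
move/subnKC <-; elim: (n - m)%N => [|k IHk]; first by rewrite addn0 !big_geq.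
have mk : (m.*2 <= (m + k).*2)%N by rewrite leq_double leq_addr.
rewrite addnS doubleS !big_nat_recr ?leq_addr ?(leqW mk) //=.
by rewrite IHk Monoid.mulmA.
Qed.

Definition riesz_term (R : realType) (mu : probability walsh_group R) (p : R)
    (Phi : nat -> R) (f : nat -> walsh_group -> R) (n : nat) : \bar R :=
  ((ln n%:R `^ p)%:E * Lnorm mu p%:E (EFin \o riesz_mean mu f n) `^ p
   * (Phi n)%:E * ((n%:R `^ (2 - 2 * p))^-1)%:E)%E.

(** With N = 2 ^ (a + 1), both 2 ^ (- a) and 1 / n are at least 1 / N, so the p-th power contributes
    N ^ (- 2 p), which turns the weight N ^ (- (2 - 2 p)) into N ^ (- 2). As N ^ 2 = 4 * 4 ^ a, the
    constant is 3 * 2 * 4 = 24. *)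
Lemma riesz_pair_constant_le (R : realType) (p A u phi : R) (a n : nat) :
  0 < p -> 0 <= A -> 0 <= u -> 0 <= phi -> A `^ p = u * 2 ^+ a ->
  (0 < n)%N -> (n <= 2 ^ a.+1)%N ->
  phi * u * 2^-1 ^+ a / 24 <=
  3^-1 * phi * ((2 ^ a.+1)%:R `^ (2 - 2 * p))^-1 *
    ((A * 2^-1 ^+ a / n%:R) `^ p / 2).
Proof.
move=> p0 A0 u0 phi0 Ap n0 nN; set N : R := (2 ^ a.+1)%:R.
have X0 : 0 < 2 ^+ a :> R by rewrite exprn_gt0.
have NE : N = 2 * 2 ^+ a by rewrite /N natrX exprS.
have N0 : 0 < N by rewrite NE mulr_gt0.
have n0' : 0 < n%:R :> R by rewrite ltr0n.
have frac_ge : N `^ (- 2) `^ p <= (2^-1 ^+ a / n%:R) `^ p.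
  apply: ge0_ler_powR; rewrite ?nnegrE ?powR_ge0 ?divr_ge0 ?exprn_ge0 ?(ltW p0) //.
  rewrite powR_invn ?(ltW N0) // -exprVn expr2 exprVn.
  apply: ler_pM; rewrite ?invr_ge0 ?(ltW N0) //; rewrite lef_pV2 ?posrE //.
    by rewrite NE ler_pMl // ler1n.
  by rewrite ler_nat.
have pow_ge : (N ^+ 2)^-1 <= (N `^ (2 - 2 * p))^-1 * (2^-1 ^+ a / n%:R) `^ p.
  apply: le_trans (ler_wpM2l _ frac_ge); last by rewrite invr_ge0 powR_ge0.
  rewrite -powRrM -powRN -powRD; last by rewrite (gt_eqF N0) implybT.
  by rewrite (_ : - (2 - 2 * p) + - 2 * p = - 2%:R) ?powR_invn ?(ltW N0) //; ring.
have -> : (A * 2^-1 ^+ a / n%:R) `^ p = u * 2 ^+ a * (2^-1 ^+ a / n%:R) `^ p.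
  by rewrite -mulrA powRM ?divr_ge0 ?exprn_ge0 // Ap.
have -> : phi * u * 2^-1 ^+ a / 24 =
    (3^-1 * phi * (u * 2 ^+ a) / 2) * (N ^+ 2)^-1.
  by rewrite NE exprVn; field; rewrite gt_eqF.
apply: le_trans (ler_wpM2l _ pow_ge) _.
  by rewrite !mulr_ge0 // ltW.
by rewrite le_eqVlt; apply/orP; left; apply/eqP; ring.
Qed.

(** Blocks of mass at least c exist beyond every index, so K disjoint ones can be chosen
    successively, and some partial sum is at least K c. *)
Lemma nneseries_blocks_pinfty (R : realType) (t : nat -> \bar R) (c : R) :
  0 < c -> (forall n, 0 <= t n)%E ->
  (forall m, exists k l, (m <= k <= l)%N /\
     (c%:E <= \sum_(k <= n < l) t n)%E) ->
  (\sum_(1 <= n <oo) t n = +oo)%E.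
Proof.
move=> c0 t0 blocks.
have partial (K : nat) : exists2 M, (0 < M)%N &
    ((K%:R * c)%:E <= \sum_(1 <= n < M) t n)%E.
  elim: K => [|K [M M0 leM]]; first by exists 1%N; rewrite // mul0r big_geq.
  have [k [l [/andP[Mk kl] ckl]]] := blocks M.
  exists l; first exact: leq_trans M0 (leq_trans Mk kl).
  rewrite (big_cat_nat M0 (leq_trans Mk kl)) (big_cat_nat Mk kl) /=.
  rewrite -natr1 mulrDl mul1r EFinD; apply: leeD => //.
  by apply: le_trans ckl _; rewrite leeDr // sume_ge0.
apply/eqyP => B B0; have [M _ leM] := partial (Num.bound (B / c)).
apply: (@le_trans _ _ (\sum_(1 <= n < M) t n)%E); last exact: nneseries_lim_ge.
apply: le_trans leM; rewrite lee_fin -ler_pdivrMr // ltW // archi_boundP //.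
by rewrite divr_ge0 // ltW.
Qed.

(** * Lower bound for the Riesz means over a dyadic block *)

Section riesz_lower_bound.
Local Open Scope ereal_scope.
Context (R : realType) (mu : probability walsh_group R).
Variables (mu_haar : is_haar mu) (p : R) (p0 : (0 < p)%R) (p1 : (p <= 1)%R).
Variable A : nat -> R.
Hypotheses (A_ge0 : forall a, (0 <= A a)%R) (A0 : A 0%N = 0%R).

Let f := haar_series A.
Let S := walsh_partial_sum mu f.
(** The unnormalized mean l_n R_n f, whose consecutive values differ by the single term S_n f /
    n. *)
Let Q n x := (\sum_(1 <= k < n.+1) S k x / k%:R)%R.

Lemma determined_by_walsh_partial_sum (n : nat) : determined_by n (S n).
Proof.
apply: determined_by_sum => i /= i_n x y xy; congr (_ * _)%R.
by apply: determined_byW (@determined_by_walsh R i) _ _ xy; exact: ltnW.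
Qed.

Lemma determined_by_riesz_numerator (n : nat) : determined_by n (Q n).
Proof.
apply: determined_by_sum => i /= /andP[_ i_n] x y xy; congr (_ / _)%R.
by apply: determined_byW (@determined_by_walsh_partial_sum i) _ _ xy.
Qed.

Let I n := \int[mu]_x (`|Q n x| `^ p)%:E.

Let mQ n : measurable_fun [set: walsh_group] (fun x => (`|Q n x| `^ p)%:E).
Proof.
apply/measurable_EFinP; apply: (@determined_by_measurable_fun _ _ n).
exact: (determined_by_comp (fun y => `|y| `^ p)%R
  (@determined_by_riesz_numerator n)).
Qed.

Let I_ge0 n : 0 <= I n.
Proof. by apply: integral_ge0 => x _; rewrite lee_fin powR_ge0. Qed.

Lemma riesz_mean_Lnorm (n : nat) : (0 < n)%N ->
  Lnorm mu p%:E (EFin \o riesz_mean mu f n) `^ p =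
  ((log_weight R n)^-1 `^ p)%:E * I n.
Proof.
move=> n0; have l0 := log_weight_gt0 R n0.
rewrite poweR_Lnorm ?gt_eqF // -ge0_integralZl //; last first.
  by rewrite lee_fin powR_ge0.
apply: eq_integral => x _ /=.
rewrite /riesz_mean -EFinM -powRM ?invr_ge0 ?(ltW l0) //.
by rewrite normrM ger0_norm // invr_ge0 ltW.
Qed.

(** The ratio ln n / l_n is at least 1 / 3, and (1 / 3) ^ p >= 1 / 3 because p <= 1. The bound N
    replaces n in the weight so that both members of a pair get the same factor. *)
Lemma riesz_mean_term_ge (Phi : nat -> R) (N n : nat) (c : R) :
  (1 < n)%N -> (n <= N)%N -> (0 <= c)%R -> (c <= Phi n)%R ->
  (3^-1 * c * (N%:R `^ (2 - 2 * p))^-1)%:E * I n <= riesz_term mu p Phi f n.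
Proof.
move=> n1 nN c0 cPhi; have n0 : (0 < n)%N by exact: ltnW.
have l0 := log_weight_gt0 R n0.
rewrite /riesz_term riesz_mean_Lnorm // muleA -EFinM.
rewrite -!muleA -EFinM [I n * _]muleC muleA -EFinM.
apply: lee_wpmul2r => //; rewrite lee_fin [leRHS]mulrA.
have ln0 : (0 <= ln n%:R :> R)%R by rewrite ln_ge0 // ler1n.
have pow_ge : (3^-1 <= ln n%:R `^ p * (log_weight R n)^-1 `^ p)%R.
  rewrite -powRM ?invr_ge0 ?(ltW l0) //.
  apply: (@le_trans _ _ (3^-1 `^ p)%R).
    by apply: ger1_powR => //; apply/andP; split; lra.
  apply: ge0_ler_powR; rewrite ?nnegrE ?(ltW p0) ?invr_ge0 ?mulr_ge0 ?invr_ge0 ?(ltW l0) //.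
  rewrite ler_pdivlMr // mulrC; have ? := log_weight_le R n1; lra.
have N_le : ((N%:R `^ (2 - 2 * p))^-1 <= (n%:R `^ (2 - 2 * p))^-1 :> R)%R.
  have n0' : (0 < n%:R :> R)%R by rewrite ltr0n.
  have N0' : (0 < N%:R :> R)%R by rewrite ltr0n (leq_trans n0).
  rewrite lef_pV2 ?posrE ?powR_gt0 //.
  apply: ge0_ler_powR; rewrite ?nnegrE ?ler0n ?ler_nat //.
  by rewrite subr_ge0 ger_pMr.
apply: ler_pM; rewrite ?mulr_ge0 ?invr_ge0 ?powR_ge0 //; exact: ler_pM.
Qed.

(** On {x_0 = 1}, a set of measure 1 / 2, the difference of the two numerators has constant modulus;
    subadditivity of the p-th power bounds its power by the sum of theirs. *)
Lemma riesz_numerator_pair_ge (j : nat) :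
  ((A (trunc_log 2 j.*2) * 2^-1 ^+ trunc_log 2 j.*2 / j.*2.+1%:R) `^ p / 2)%:E
  <= I j.*2 + I j.*2.+1.
Proof.
set K := (_ `^ p)%R; pose B : set walsh_group := ~` dyadic_interval 1 wg_zero.
have mB : measurable B by apply: measurableC; exact: measurable_dyadic_interval.
have muB : mu B = (2^-1)%:E.
  rewrite probability_setC; last exact: measurable_dyadic_interval.
  rewrite [X in 1 - X](haar_dyadic_interval0 mu_haar 1) -EFinB expr1.
  by congr EFin; lra.
have K0 : (0 <= K)%R by exact: powR_ge0.
have -> : (K / 2)%:E = \int[mu]_x (K%:E * (\1_B x)%:E).
  rewrite ge0_integralZl ?lee_fin //; last exact/measurable_EFinP.
  by rewrite integral_indic // setIT EFinM; congr (_ * _); rewrite -muB.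
rewrite -ge0_integralD //.
apply: ge0_le_integral => //.
- by move=> x _; rewrite mule_ge0 // lee_fin.
- by apply/measurable_EFinP; apply: measurable_funM.
- by apply: emeasurable_funD.
move=> x _; rewrite indicE; have [|_] := boolP (x \in B); last first.
  by rewrite mule0 adde_ge0 // lee_fin powR_ge0.
rewrite inE mule1 -EFinD lee_fin => Bx.
have x0 : x 0%N.
  by apply: contra_notT Bx => /negbTE x0 [|//].
have Q_diff : (S j.*2.+1 x / j.*2.+1%:R = Q j.*2.+1 x - Q j.*2 x)%R.
  by rewrite {1}/Q big_nat_recr //= addrAC subrr add0r.
have -> : K = (`|Q j.*2.+1 x - Q j.*2 x| `^ p)%R.
  rewrite -Q_diff /S walsh_partial_sum_haar_series_odd //.
  rewrite !normrM normr_walsh mulr1 normfV normr_nat.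
  by rewrite (ger0_norm (A_ge0 _)) ger0_norm // exprn_ge0 // invr_ge0.
rewrite [leRHS]addrC; apply: le_trans (powRD_le p0 p1 _ _) => //.
apply: ge0_ler_powR; rewrite ?nnegrE ?addr_ge0 ?(ltW p0) //.
exact: ler_normB.
Qed.

Lemma riesz_term_block_ge (Phi : nat -> R) (u : R) (a : nat) :
  (0 < a)%N -> (0 <= u)%R -> (A a `^ p = u * 2 ^+ a)%R ->
  (forall n, 0 <= Phi n)%R ->
  (forall m n, (m <= n)%N -> (Phi m <= Phi n)%R) ->
  (Phi (2 ^ a)%N * u / 48)%:E <=
  \sum_(2 ^ a <= n < 2 ^ a.+1) riesz_term mu p Phi f n.
Proof.
move=> a0 u0 Ap Phi0 Phi_nd.
case: a a0 Ap => [//|b] _ Ap; set a := b.+1.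
pose c : R := (Phi (2 ^ a)%N * u * 2^-1 ^+ a / 24)%R.
(* With a = b + 1, the block consists of 2 ^ b pairs (2 j, 2 j + 1), each contributing at least c; 2
   ^ b * 2 ^ (- a) / 24 = 1 / 48. *)
have -> : (Phi (2 ^ a)%N * u / 48)%:E = \sum_(2 ^ b <= j < 2 ^ b.+1) c%:E.
  rewrite sumEFin sumr_const_nat; congr EFin.
  have -> : (2 ^ b.+1 - 2 ^ b = 2 ^ b)%N by rewrite expnS mul2n -addnn addnK.
  rewrite -[RHS]mulr_natr natrX /c /a exprS exprVn; field.
  by rewrite expf_neq0.
have -> : \sum_(2 ^ a <= n < 2 ^ a.+1) riesz_term mu p Phi f n =
    \sum_(2 ^ b <= j < 2 ^ b.+1)
      (riesz_term mu p Phi f j.*2 + riesz_term mu p Phi f j.*2.+1).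
  by rewrite -big_nat_double ?leq_exp2l // -!mul2n -!expnS.
rewrite big_nat [leRHS]big_nat; apply: lee_sum => j /andP[jlo jhi].
have lo : (2 ^ a <= j.*2)%N by rewrite /a expnS mul2n leq_double.
have hi : (j.*2.+1 < 2 ^ a.+1)%N.
  by rewrite expnS mul2n -doubleS leq_double.
have j1 : (1 < j.*2)%N.
  by apply: leq_trans lo; rewrite /a expnS mul2n -[2%N]/(1.*2)%N leq_double expn_gt0.
have tj : trunc_log 2 j.*2 = a.
  by apply: trunc_log_eq => //; rewrite lo ltnW.
have le_term n : (2 ^ a <= n)%N -> (n < 2 ^ a.+1)%N ->
    (3^-1 * Phi (2 ^ a)%N * ((2 ^ a.+1)%:R `^ (2 - 2 * p))^-1)%:E * I n <=
    riesz_term mu p Phi f n.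
  move=> an na; apply: riesz_mean_term_ge => //.
  - by apply: leq_trans an; rewrite /a expnS mul2n -[2%N]/(1.*2)%N leq_double expn_gt0.
  - exact: ltnW.
  - exact: Phi_nd.
apply: le_trans (leeD (le_term _ lo (ltnW hi)) (le_term _ (leqW lo) hi)).
rewrite -ge0_muleDr //.
apply: le_trans (lee_wpmul2l _ (riesz_numerator_pair_ge j)); last first.
  by rewrite lee_fin !mulr_ge0 ?invr_ge0 ?powR_ge0.
rewrite -EFinM lee_fin tj; apply: riesz_pair_constant_le => //.
exact: ltnW.
Qed.

End riesz_lower_bound.

(** * Telescoping sums and conclusion *)

Lemma sum_inverse_increments (R : realType) (psi : nat -> R) (n : nat) :
  (forall a, 1 <= psi a) ->
  \sum_(1 <= a < n) ((psi a)^-1 - (psi a.+1)^-1) <= 1.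
Proof.
move=> psi1; have [n1|n1] := leqP n 1; first by rewrite big_geq.
rewrite (telescope_sumr_eq (fun a => - (psi a)^-1)) 1?ltnW //; last first.
  by move=> a _; rewrite opprK addrC.
rewrite opprK addrC; have psi_inv a : 0 <= (psi a)^-1.
  by rewrite invr_ge0 (le_trans _ (psi1 a)).
apply: le_trans (_ : (psi 1%N)^-1 <= 1); first by rewrite gerBl.
by rewrite invf_le1 // (lt_le_trans ltr01).
Qed.

(** Each summand is (psi (a + 1) - psi a) / psi (a + 1). Enlarging the denominator to psi M makes
    the sum telescope to 1 - psi m / psi M, at least 1 / 2. *)
Lemma sum_relative_increments (R : realType) (psi : nat -> R) (m M : nat) :
  (forall a, 1 <= psi a) -> (forall a b, (a <= b)%N -> psi a <= psi b) ->
  (m <= M)%N -> 2 * psi m <= psi M ->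
  2^-1 <= \sum_(m <= a < M) psi a * ((psi a)^-1 - (psi a.+1)^-1).
Proof.
move=> psi1 psi_nd mM le2.
have psi0 a : 0 < psi a by exact: lt_le_trans ltr01 (psi1 a).
apply: (@le_trans _ _ (\sum_(m <= a < M) (psi a.+1 - psi a) / psi M)).
  rewrite -mulr_suml telescope_sumr // ler_pdivlMr //; lra.
rewrite big_nat [leRHS]big_nat; apply: ler_sum => a /andP[_ aM].
have -> : psi a * ((psi a)^-1 - (psi a.+1)^-1) =
    (psi a.+1 - psi a) / psi a.+1.
  by field; rewrite !gt_eqF.
rewrite ler_wpM2l ?subr_ge0 ?psi_nd //.
by rewrite lef_pV2 ?posrE // psi_nd.
Qed.

Lemma big_nat_dyadic_blocks (R : realType) (t : nat -> \bar R) (m M : nat) :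
  (m <= M)%N ->
  (\sum_(2 ^ m <= n < 2 ^ M) t n =
   \sum_(m <= a < M) \sum_(2 ^ a <= n < 2 ^ a.+1) t n)%E.
Proof.
move/subnKC <-; elim: (M - m)%N => [|k IHk]; first by rewrite addn0 !big_geq.
rewrite addnS big_nat_recr ?leq_addr //= -IHk -big_cat_nat //.
- by rewrite leq_exp2l // leq_addr.
- by rewrite leq_exp2l.
Qed.

Theorem theorem2 (R : realType) (mu : probability walsh_group R)
    (mu_haar : is_haar mu) (p : R) (p_gt0 : 0 < p) (p_lt_half : p < 1 / 2)
    (Phi : nat -> R) (Phi_ge1 : forall n, 1 <= Phi n)
    (Phi_nd : forall m n, (m <= n)%N -> Phi m <= Phi n)
    (Phi_cvg : Phi n @[n --> \oo] --> +oo) :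
  exists f : nat -> walsh_group -> R,
    in_hardy mu p f /\
    (\sum_(1 <= n <oo)
       ((ln n%:R `^ p)%:E * Lnorm mu p%:E (EFin \o riesz_mean mu f n) `^ p
        * (Phi n)%:E * ((n%:R `^ (2 - 2 * p))^-1)%:E) = +oo)%E.
Proof.
have p1 : p <= 1 by lra.
have p_neq0 : p != 0 by rewrite gt_eqF.
pose psi a := Phi (2 ^ a)%N.
have psi1 a : 1 <= psi a by exact: Phi_ge1.
have psi_nd a b : (a <= b)%N -> psi a <= psi b.
  by move=> ab; apply: Phi_nd; rewrite leq_exp2l.
have psi0 a : 0 < psi a by exact: lt_le_trans ltr01 (psi1 a).
have Phi0 n : 0 <= Phi n by exact: le_trans ler01 (Phi_ge1 n).
(* The value at 0 is forced to 0 so that [A 0] vanishes, as the coefficient formula requires. *)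
pose u a := if a is 0%N then 0 else (psi a)^-1 - (psi a.+1)^-1.
have u0 a : 0 <= u a.
  by case: a => [//|a]; rewrite subr_ge0 lef_pV2 ?posrE // psi_nd.
pose A a := (u a * 2 ^+ a) `^ p^-1.
have A_ge0 a : 0 <= A a by exact: powR_ge0.
have A0 : A 0%N = 0 by rewrite /A mul0r powR0 // invr_eq0.
have Ap a : A a `^ p = u a * 2 ^+ a.
  by rewrite -powRrM mulVf // powRr1 // mulr_ge0 // exprn_ge0.
exists (haar_series A); split.
  apply: (haar_series_in_hardy mu_haar (M := 1)) => // n.
  have -> : \sum_(0 <= a < n) A a `^ p * 2^-1 ^+ a = \sum_(0 <= a < n) u a.
    by apply: eq_bigr => a _; rewrite Ap exprVn mulfK // expf_neq0.
  case: n => [|n]; first by rewrite big_geq.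
  rewrite big_ltn // add0r; apply: le_trans (sum_inverse_increments n.+1 psi1).
  by rewrite big_nat [leRHS]big_nat; apply: ler_sum => -[].
(* Each run of dyadic blocks over which psi doubles gives 1 / 2 from the relative increments, times
   1 / 48 from the block bound. *)
apply: (@nneseries_blocks_pinfty _ (riesz_term mu p Phi (haar_series A)) 96^-1).
- by rewrite invr_gt0.
- by move=> n; rewrite /riesz_term !mule_ge0 ?poweR_ge0 ?lee_fin ?invr_ge0 ?powR_ge0.
(* Starting at k >= 1 avoids the exceptional value u 0, and 2 ^ k exceeds m. *)
move=> m; pose k := m.+1.
have [N _ leN] : \forall n \near \oo, 2 * psi k <= Phi n.
  by move/cvgryPge : Phi_cvg; exact.
(* Since 2 ^ M > M >= N, the value psi M = Phi (2 ^ M) is at least 2 psi k. *)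
pose M := maxn k N; have kM : (k <= M)%N by rewrite leq_maxl.
have le2 : 2 * psi k <= psi M.
  apply: leN => /=; apply: leq_trans (leq_maxr k N) _.
  exact: ltnW (ltn_expl _ _).
exists (2 ^ k)%N, (2 ^ M)%N; split.
  rewrite leq_exp2l // kM andbT.
  by apply: leq_trans (leqnSn m) (ltnW (ltn_expl _ _)).
rewrite big_nat_dyadic_blocks //.
have := sum_relative_increments psi1 psi_nd kM le2.
rewrite -(ler_pM2r (_ : 0 < 48^-1)) ?invr_gt0 // -invfM mulr_suml => le_sum.
apply: (@le_trans _ _ (\sum_(k <= a < M) (psi a * u a / 48)%:E)%E).
  rewrite sumEFin lee_fin (_ : 96 = 2 * 48); last by ring.
  apply: le_trans le_sum _; rewrite big_nat [leRHS]big_nat.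
  by apply: ler_sum => -[].
rewrite big_nat [leRHS]big_nat; apply: lee_sum => a /andP[ka _].
apply: riesz_term_block_ge => //.
exact: leq_trans ka.
Qed.
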